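(* Let $X$ be a nonempty compact Hausdorff topological space. Let $w_1,\dots,w_N:X\to X$ be continuous maps, let $p_1,\dots,p_N>0$ with $\sum_{i=1}^N p_i=1$, and let $M(\mu)=\sum_{i=1}^N p_i\,\mu\circ w_i^{-1}$ be the associated Markov operator. Then there exists a Radon probability measure $\mu_*$ on $X$ with $M(\mu_* )=\mu_*$.
   Context: A Borel probability measure $\mu$ on $X$ is Radon if $\mu(B)=\sup\{\mu(K):K\subseteq B\text{ compact}\}$ for every Borel set $B$. $\mu\circ w^{-1}$ denotes the push-forward $B\mapsto\mu(w^{-1}(B))$. The Markov operator acts on the vector space of signed Radon measures (differences of two finite Radon measures) on $X$. *)

(* Defs.v *)
From HB Require Import structures.
From mathcomp Require Import all_boot all_order all_algebra.
From mathcomp Require Import all_classical all_reals all_analysis.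

Set Implicit Arguments.
Unset Strict Implicit.
Unset Printing Implicit Defensive.
Import Order.TTheory GRing.Theory Num.Theory.
Import numFieldNormedType.Exports.

Local Open Scope classical_set_scope.
Local Open Scope ring_scope.
Local Open Scope ereal_scope.

Notation borel X := (g_sigma_algebraType (@open X)).

Definition radon (R : realType) (X : ptopologicalType)
    (mu : set (borel X) -> \bar R) : Prop :=
  forall B : set (borel X), measurable B ->
    mu B = ereal_sup [set mu K | K in [set K : set X | compact K /\ K `<=` B]].

(* Only the values on Borel sets are constrained: the values of a set function
   outside the sigma-algebra carry no information. *)
Definition signed_radon (R : realType) (X : ptopologicalType)
    (mu : set (borel X) -> \bar R) : Prop :=
  exists mu1 mu2 : {finite_measure set (borel X) -> \bar R},
    [/\ radon mu1, radon mu2 &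
      forall B : set (borel X), measurable B -> mu B = mu1 B - mu2 B].

(* Defined on all set functions; [markov_op_signed_radon] below shows that it
   acts on the signed Radon measures. *)
Definition markov_op (R : realType) (X : ptopologicalType) (N : nat)
    (w : 'I_N -> X -> X) (p : 'I_N -> R)
    (mu : set (borel X) -> \bar R) : set (borel X) -> \bar R :=
  fun B => \sum_(i < N) (p i)%:E * @pushforward _ _ (borel X) (borel X) R mu (w i) B.

Section finite_measure_of.
Context d (T : measurableType d) (R : realType).
Variables (mu : {measure set T -> \bar R}) (fmu : fin_num_fun mu).

Definition finite_measure_of & fin_num_fun mu : set T -> \bar R := mu.
HB.instance Definition _ := Measure.on (finite_measure_of fmu).
HB.instance Definition _ :=
  Measure_isFinite.Build _ _ _ (finite_measure_of fmu) fmu.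

End finite_measure_of.

Section signed_radon_theory.
Context (R : realType) (X : ptopologicalType).
Implicit Types (mu nu : set (borel X) -> \bar R) (w : X -> X).

Lemma continuous_borel_measurable (w : X -> X) : continuous w ->
  measurable_fun [set: borel X] (w : borel X -> borel X).
Proof.
move=> /continuousP cw; apply: (@measurability _ _ (borel X) (borel X) setT w (@open X)) => //.
move=> _ [B oB <-]; rewrite setTI.
by apply: sub_sigma_algebra; exact: cw.
Qed.

Lemma compact_borel (K : set X) : hausdorff_space X -> compact K ->
  measurable (K : set (borel X)).
Proof.
move=> hX cK; rewrite -(setCK K); apply: measurableC.
apply: sub_sigma_algebra; rewrite openC.
exact: compact_closed.
Qed.

Section radon_approx.
Hypothesis hX : hausdorff_space X.
Variable mu : {finite_measure set (borel X) -> \bar R}.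

Lemma radonP : radon mu <->
  forall (B : set (borel X)) (e : R), measurable B -> (0 < e)%R ->
    exists K : set X, [/\ compact K, K `<=` B & mu B <= mu K + e%:E].
Proof.
split=> [rmu B e mB e0|H B mB].
  have fB : mu B \is a fin_num by exact: fin_num_measure.
  have : mu B - e%:E < mu B by rewrite lteBlDr// lteDl.
  rewrite {2}(rmu _ mB) => /ereal_sup_gt[_ [K [cK KB] <-] h].
  by exists K; split => //; rewrite -leeBlDr//; exact: ltW.
apply/eqP; rewrite eq_le; apply/andP; split.
  apply/lee_addgt0Pr => e e0.
  have [K [cK KB h]] := H B e mB e0.
  apply: (le_trans h); rewrite leeD2r//; apply: ereal_sup_ubound.
  by exists K.
apply: ge_ereal_sup => _ [K [cK KB] <-].
by apply: le_measure => //; rewrite inE//; exact: compact_borel.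
Qed.
End radon_approx.

Lemma signed_radon0 : @signed_radon R X (fun=> 0).
Proof.
exists mzero, mzero; split=> //; last by move=> B _; rewrite /mzero sube0.
all: move=> B _; apply/eqP; rewrite eq_le; apply/andP; split.
all: try by apply: ereal_sup_ubound; exists set0 => //; split;
  [exact: compact0|exact: sub0set].
all: by apply: ge_ereal_sup => _ [K _ <-].
Qed.

Lemma signed_radonD mu nu : hausdorff_space X ->
  signed_radon mu -> signed_radon nu -> signed_radon (mu \+ nu).
Proof.
move=> hX [m1 [m2 [r1 r2 E1]]] [n1 [n2 [s1 s2 E2]]].
have addR (a b : {finite_measure set (borel X) -> \bar R}) :
    radon a -> radon b ->
    exists c : {finite_measure set (borel X) -> \bar R},
      radon c /\ forall B, c B = a B + b B.
  move=> ra rb.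
  have fc : fin_num_fun (measure_add a b).
    by move=> B mB; rewrite measure_addE fin_numD !fin_num_measure.
  pose c : {finite_measure set (borel X) -> \bar R} := finite_measure_of fc.
  have cE B : c B = a B + b B by rewrite -measure_addE.
  exists c; split=> //; apply/radonP => // B e mB e0.
  have e20 : (0 < e / 2)%R by rewrite divr_gt0.
  have [K1 [cK1 K1B h1]] := (radonP hX a).1 ra B _ mB e20.
  have [K2 [cK2 K2B h2]] := (radonP hX b).1 rb B _ mB e20.
  exists (K1 `|` K2); split; first exact: compactU.
    by move=> x [/K1B|/K2B].
  rewrite !cE (splitr e) EFinD addeACA; apply: leeD.
    apply: (le_trans h1); rewrite leeD2r//; apply: le_measure => //.
    - by rewrite inE; exact: compact_borel.
    - by rewrite inE; apply: measurableU; exact: compact_borel.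
  apply: (le_trans h2); rewrite leeD2r//; apply: le_measure => //.
  - by rewrite inE; exact: compact_borel.
  - by rewrite inE; apply: measurableU; exact: compact_borel.
have [c1 [rc1 c1E]] := addR _ _ r1 s1.
have [c2 [rc2 c2E]] := addR _ _ r2 s2.
exists c1, c2; split=> // B mB.
rewrite c1E c2E E1// E2// fin_num_oppeD ?fin_num_measure//.
by rewrite addeACA.
Qed.

Lemma signed_radonZ (r : R) mu : hausdorff_space X ->
  (0 <= r)%R -> signed_radon mu -> signed_radon (fun B => r%:E * mu B).
Proof.
move=> hX r0 [m1 [m2 [r1 r2 E]]].
have scR (a : {finite_measure set (borel X) -> \bar R}) : radon a ->
    exists c : {finite_measure set (borel X) -> \bar R},
      radon c /\ forall B, c B = r%:E * a B.
  move=> ra; pose q := NngNum r0.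
  pose c : {finite_measure set (borel X) -> \bar R} := mscale q a.
  exists c; split=> //; apply/radonP => // B e mB e0.
  have d0 : (0 < e / (r + 1))%R by rewrite divr_gt0// ltr_wpDl.
  have [K [cK KB hK]] := (radonP hX a).1 ra B _ mB d0.
  exists K; split=> //.
  have -> : c B = r%:E * a B by [].
  have -> : c K = r%:E * a K by [].
  apply: (@le_trans _ _ (r%:E * (a K + (e / (r + 1))%:E))).
    by apply: lee_wpmul2l => //; rewrite lee_fin.
  rewrite ge0_muleDr ?measure_ge0 ?lee_fin ?(ltW d0)//.
  rewrite leeD2l// lee_fin mulrA ler_pdivrMr ?ltr_wpDl//.
  by rewrite mulrC ler_wpM2l// ?lerDl// ltW.
have [c1 [rc1 c1E]] := scR _ r1.
have [c2 [rc2 c2E]] := scR _ r2.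
exists c1, c2; split=> // B mB.
by rewrite c1E c2E E// muleBr// fin_num_adde_defl// fin_numN fin_num_measure.
Qed.

Lemma signed_radon_pushforward (w : X -> X) mu : hausdorff_space X ->
  continuous w -> signed_radon mu ->
  signed_radon (@pushforward _ _ (borel X) (borel X) R mu w).
Proof.
move=> hX cw [m1 [m2 [r1 r2 E]]].
have mw := continuous_borel_measurable cw.
have mpre (B : set (borel X)) : measurable B ->
    measurable (w @^-1` B : set (borel X)).
  by move=> mB; rewrite -[X in measurable X]setTI; exact: mw.
have pR (a : {finite_measure set (borel X) -> \bar R}) : radon a ->
    exists c : {finite_measure set (borel X) -> \bar R},
      radon c /\ forall B, c B = a (w @^-1` B).
  move=> ra.
  pose c0 : {measure set (borel X) -> \bar R} :=
    @measure_function_pushforward__canonical__measure_function_Measure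
      _ _ (borel X) (borel X) R a w mw.
  have fc : fin_num_fun c0.
    by move=> B mB; apply: fin_num_measure; exact: mpre.
  pose c : {finite_measure set (borel X) -> \bar R} := finite_measure_of fc.
  have cE B : c B = a (w @^-1` B) by [].
  exists c; split=> //; apply/radonP => // B e mB e0.
  have [K [cK KB hK]] := (radonP hX a).1 ra _ _ (mpre _ mB) e0.
  have cwK : compact (w @` K).
    by apply: continuous_compact => //; exact: continuous_subspaceT.
  exists (w @` K); split=> //.
    by move=> _ [x Kx <-]; exact: KB.
  rewrite !cE; apply: (le_trans hK); rewrite leeD2r//; apply: le_measure.
  - by rewrite inE; exact: compact_borel.
  - by rewrite inE; apply: mpre; exact: compact_borel.
  - by move=> x Kx; exists x.
have [c1 [rc1 c1E]] := pR _ r1.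
have [c2 [rc2 c2E]] := pR _ r2.
exists c1, c2; split=> // B mB.
by rewrite c1E c2E /pushforward E//; exact: mpre.
Qed.

Lemma markov_op_signed_radon (N : nat) (w : 'I_N -> X -> X) (p : 'I_N -> R) mu :
  hausdorff_space X -> (forall i, continuous (w i)) ->
  (forall i, (0 < p i)%R) -> signed_radon mu -> signed_radon (markov_op w p mu).
Proof.
move=> hX cw p0 rmu.
rewrite /markov_op; elim: (index_enum _) => [|i s IH].
  by under eq_fun do rewrite big_nil; exact: signed_radon0.
under eq_fun do rewrite big_cons.
apply: signed_radonD => //.
by apply: signed_radonZ => //; [exact: ltW|exact: signed_radon_pushforward].
Qed.

Lemma probability_signed_radon (mu : probability (borel X) R) :
  radon mu -> signed_radon mu.
Proof.
move=> rmu; exists mu, mzero; split=> //.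
  move=> B _; apply/eqP; rewrite eq_le; apply/andP; split.
    by apply: ereal_sup_ubound; exists set0 => //; split;
      [exact: compact0|exact: sub0set].
  by apply: ge_ereal_sup => _ [K _ <-].
by move=> B _; rewrite /mzero sube0.
Qed.

End signed_radon_theory.

(* Main.v *)
Require Import Defs.
From HB Require Import structures.
From mathcomp Require Import all_boot all_order all_algebra.
From mathcomp Require Import all_classical all_reals all_analysis.
From mathcomp Require Import lra.

(* An ultrafilter limit of the Cesaro means of the iterates M^k delta_x is a
   finitely additive probability nu on all subsets of X with M nu = nu. Its
   inner values lambda U = sup {nu K | K compact, K included in U} on open sets
   generate an outer measure whose restriction mu to the Borel sets is a Radon
   probability. Since w_i^-1 K is a compact subset of w_i^-1 U, invariance of nu
   gives mu U <= (M mu) U for U open. Taking complements, (M mu) K <= mu K for K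
   compact; inner regularity extends this to Borel sets, and taking complements
   once more turns it into an equality. *)

Set Implicit Arguments.
Unset Strict Implicit.
Unset Printing Implicit Defensive.
Import Order.TTheory GRing.Theory Num.Theory.
Import numFieldNormedType.Exports.

Local Open Scope classical_set_scope.
Local Open Scope ring_scope.

(** * Ultrafilter limits and finitely additive probabilities *)

Lemma ultra_cvg_compact (T : Type) (U : topologicalType) (F : set_system T)
    (f : T -> U) (A : set U) :
  UltraFilter F -> compact A -> (forall t, A (f t)) ->
  exists2 l, A l & f @ F --> l.
Proof.
move=> FU cA Af.
have [|l [Al cl]] := cA (f @ F) _.
  by apply: (@filterS _ F _ setT) => [t _|]; [exact: Af|exact: filterT].
exists l => // V lV.
(* For an ultrafilter a cluster point is a limit: if [f @^-1] V[were not in]F[, its complement would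
   be, and clustering at]l[would make]V[meet]~[V]. *)
have [//|FnV] := in_ultra_setVsetC (f @^-1` V) FU.
by have [y [/= nVy Vy]] := cl (~` V) V FnV lV.
Qed.

(** Defined on every subset, so that preimages and setwise limits raise no measurability question;
    countable additivity is recovered only by the regularization. *)
Definition additive_prob (R : realType) (T : Type) (f : set T -> R) :=
  [/\ forall A, 0 <= f A, f setT = 1 &
      forall A B, A `&` B = set0 -> f (A `|` B) = f A + f B].

Lemma additive_prob0 (R : realType) (T : Type) (f : set T -> R) :
  additive_prob f -> f set0 = 0.
Proof.
move=> [_ _ fD]; have /esym/eqP := fD set0 set0 (setI0 _).
by rewrite setU0 -subr_eq0 addrK => /eqP.
Qed.

Lemma additive_prob_le1 (R : realType) (T : Type) (f : set T -> R) A :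
  additive_prob f -> f A <= 1.
Proof.
move=> [f0 f1 fD]; rewrite -f1 -(setUv A) fD ?setICr//.
by rewrite lerDl.
Qed.

Lemma additive_prob_le (R : realType) (T : Type) (f : set T -> R) A B :
  additive_prob f -> A `<=` B -> f A <= f B.
Proof.
move=> [f0 f1 fD] AB; rewrite -(setDUK AB) fD ?lerDl//.
by rewrite setDE setICA setICr setI0.
Qed.

Lemma additive_probU_le (R : realType) (T : Type) (f : set T -> R) A B :
  additive_prob f -> f (A `|` B) <= f A + f B.
Proof.
move=> fP; have [f0 f1 fD] := fP.
have -> : A `|` B = A `|` (B `\` A) by rewrite setDE setUIr setUv setIT.
rewrite fD; last first.
  by rewrite setDE setICA setICr setI0.
by rewrite lerD2l; apply: additive_prob_le => // x [].
Qed.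

(** * An invariant finitely additive probability *)

Section invariant_mean.
Context (R : realType) (T : pointedType) (N : nat).
Variables (w : 'I_N -> T -> T) (p : 'I_N -> R).
Hypotheses (p_ge0 : forall i, 0 <= p i) (p_sum1 : \sum_(i < N) p i = 1).

Let M (f : set T -> R) : set T -> R :=
  fun A => \sum_(i < N) p i * f (w i @^-1` A).

Let orbit k : set T -> R := iter k M (fun A => (`[< A point >])%:R).

Let cesaro n : set T -> R := fun A => (\sum_(k < n.+1) orbit k A) / n.+1%:R.

Let orbit_prob k : additive_prob (orbit k).
Proof.
elim: k => [|k [f0 f1 fD]]; split=> /=.
- by move=> A; rewrite ler0n.
- by rewrite asboolT.
- move=> A B AB; rewrite asbool_or; have := AB.
  case: (asboolP (A point)) => // Ap; case: (asboolP (B point)) => //= Bp.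
  + by move=> /seteqP[/(_ point)]; case.
  + by rewrite addr0.
  + by rewrite add0r.
  + by rewrite addr0.
- by move=> A; apply: sumr_ge0 => i _; rewrite mulr_ge0.
- rewrite /M -[RHS]p_sum1; apply: eq_bigr => i _.
  by rewrite preimage_setT f1 mulr1.
- move=> A B AB; rewrite /M -big_split/=; apply: eq_bigr => i _.
  by rewrite preimage_setU fD ?mulrDr// -preimage_setI AB preimage_set0.
Qed.

Let cesaro_prob n : additive_prob (cesaro n).
Proof.
split; rewrite /cesaro.
- move=> A; rewrite divr_ge0// sumr_ge0// => k _.
  by have [] := orbit_prob k.
- rewrite (eq_bigr (fun=> 1)) => [|k _]; last by have [] := orbit_prob k.
  by rewrite sumr_const card_ord divff.
- move=> A B AB; rewrite -mulrDl -big_split/=; congr (_ / _).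
  by apply: eq_bigr => k _; have [_ _ ->] := orbit_prob k.
Qed.

(** By linearity [M] shifts each [orbit k] to [orbit k.+1], so the difference telescopes to
    [orbit n.+1 A - orbit 0 A] over [n.+1], and both values lie in [0, 1]. *)
Let cesaro_almost_invariant n A :
  `|M (cesaro n) A - cesaro n A| <= n.+1%:R^-1.
Proof.
have -> : M (cesaro n) A = (\sum_(k < n.+1) orbit k.+1 A) / n.+1%:R.
  rewrite mulr_suml /M /cesaro; under eq_bigr do rewrite mulr_suml mulr_sumr.
  rewrite exchange_big/=; apply: eq_bigr => k _; rewrite /M mulr_suml.
  by apply: eq_bigr => i _; rewrite mulrA.
rewrite /cesaro -mulrBl.
rewrite -sumrB -(big_mkord xpredT (fun k => orbit k.+1 A - orbit k A)).
rewrite telescope_sumr// normrM normfV [`|n.+1%:R|]ger0_norm//.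
rewrite -[leRHS]mul1r ler_wpM2r ?invr_ge0//.
have /(additive_prob_le1 A) a1 := orbit_prob n.+1.
have /(additive_prob_le1 A) b1 := orbit_prob 0.
have [a0 _ _] := orbit_prob n.+1; have [b0 _ _] := orbit_prob 0.
have := a0 A; have := b0 A; rewrite ler_norml; move: a1 b1.
by move: (orbit _ _) (orbit _ _) => u v; lra.
Qed.

(** The limit is taken separately for each set. Finite additivity survives such a limit, and so does
    [M], being a finite sum. *)
Lemma invariant_additive_prob : exists2 nu : set T -> R,
  additive_prob nu & forall A, nu A = \sum_(i < N) p i * nu (w i @^-1` A).
Proof.
(* [F] refines the eventual filter, so sequences that tend to 0 in the usual sense also do so along
   [F]. *)
have [F [FU ooF]] := ultraFilterLemma (@eventually_filter).
have /choice[nu nuP] : forall A, exists l : R, cesaro ^~ A @ F --> l.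
  move=> A.
  have [| |l _ ?] := @ultra_cvg_compact nat R F (cesaro ^~ A) `[0, 1] FU.
  - exact: segment_compact.
  - move=> n /=; rewrite in_itv/=; have [c0 _ _] := cesaro_prob n.
    by rewrite c0 additive_prob_le1.
  - by exists l.
have FP : ProperFilter F by exact: ultra_proper.
have lim_uniq (u : nat -> R) (a b : R) : u @ F --> a -> u @ F --> b -> a = b.
  by apply: cvg_unique; exact: Rhausdorff.
exists nu.
  split.
  - move=> A; apply: (cvgr_to_ge (nuP A)).
    by apply: nearW => n; have [] := cesaro_prob n.
  - apply: lim_uniq (nuP setT) _.
    rewrite (_ : cesaro ^~ setT = fun=> 1); first exact: cvg_cst.
    by apply/funext => n; have [] := cesaro_prob n.
  - move=> A B AB; apply: lim_uniq (nuP _) _.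
    rewrite (_ : cesaro ^~ _ = (cesaro ^~ A) \+ (cesaro ^~ B)).
      exact: cvgD.
    by apply/funext => n; have [_ _ ->] := cesaro_prob n.
move=> A; apply/eqP; rewrite eq_sym -subr_eq0; apply/eqP.
(* The same sequence has limit [M nu A - nu A] by continuity of the operations, and limit 0 by
   comparison with the harmonic sequence. *)
apply: (lim_uniq (fun n => M (cesaro n) A - cesaro n A)).
  apply: cvgB => //; rewrite /M; apply: cvg_big => [|i _].
    exact: add_continuous.
  exact: cvgMl_tmp.
apply/norm_cvg0P.
apply: (@squeeze_cvgr _ _ _ _ (fun=> 0) (@harmonic R)).
- by apply: nearW => n; rewrite normr_ge0 cesaro_almost_invariant.
- exact: cvg_cst.
- by apply: cvg_trans cvg_harmonic; exact: cvg_app.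
Qed.

End invariant_mean.

(** * From a finitely additive probability to a regular Borel one *)

Section regularization.
Local Open Scope ereal_scope.
Context (R : realType) (X : ptopologicalType).
Hypotheses (cX : compact [set: X]) (hX : hausdorff_space X).

Let closed_compactX (K : set X) : closed K -> compact K.
Proof. by move=> cK; exact: subclosed_compact cK cX _. Qed.

(** The closed sets [K \ U] and [K \ V] are disjoint, so normality yields disjoint open sets [A] and
    [B] around them; [K \ A] and [K \ B] are the two pieces. *)
Lemma compact_split (K U V : set X) :
  compact K -> open U -> open V -> K `<=` U `|` V ->
  exists K1 K2, [/\ compact K1, compact K2, K1 `<=` U, K2 `<=` V &
                    K `<=` K1 `|` K2].
Proof.
move=> /(compact_closed hX) cK oU oV KUV.
have cKD W : open W -> closed (K `\` W).
  by move=> oW; apply: closedI => //; exact: open_closedC.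
have [|A [B [oA oB KUA KVB AB0]]] := (@normal_openP R X).1
    (compact_normal hX cX) _ _ (cKD U oU) (cKD V oV).
  rewrite -subset0 => x [[Kx nUx] [_ nVx]].
  by case: (KUV x Kx).
exists (K `\` A), (K `\` B); split.
- exact/closed_compactX/cKD.
- exact/closed_compactX/cKD.
- by move=> x [Kx nAx]; apply: contrapT => nUx; exact/nAx/KUA.
- by move=> x [Kx nBx]; apply: contrapT => nVx; exact/nBx/KVB.
- move=> x Kx; have [Ax|nAx] := pselect (A x); last by left.
  right; split=> // Bx; suff : set0 x by [].
  by rewrite -AB0.
Qed.

Variable nu : set X -> R.
Hypothesis nuP : additive_prob nu.

Definition inner_content (U : set X) : \bar R :=
  ereal_sup [set (nu K)%:E | K in [set K | compact K /\ K `<=` U]].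

Definition outer_content (A : set X) : \bar R :=
  ereal_inf [set inner_content U | U in [set U | open U /\ A `<=` U]].

Lemma inner_content_ge K U : compact K -> K `<=` U ->
  (nu K)%:E <= inner_content U.
Proof. by move=> cK KU; apply: ereal_sup_ubound; exists K. Qed.

Lemma inner_content_ge0 U : 0 <= inner_content U.
Proof.
apply: le_trans (inner_content_ge compact0 (@sub0set _ _)).
by rewrite lee_fin; have [] := nuP.
Qed.

Lemma inner_content_le1 U : inner_content U <= 1.
Proof.
by apply: ge_ereal_sup => _ [K _ <-]; rewrite lee_fin additive_prob_le1.
Qed.

Lemma inner_contentS U V : U `<=` V -> inner_content U <= inner_content V.
Proof.
move=> UV; apply: ge_ereal_sup => _ [K [cK KU] <-].
by apply: inner_content_ge => //; exact: subset_trans UV.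
Qed.

Lemma inner_content_setT : inner_content setT = 1.
Proof.
apply/eqP; rewrite eq_le inner_content_le1/=.
by have [_ <- _] := nuP; exact: inner_content_ge.
Qed.

(** A compact [L] inside [V \ K] is disjoint from [K], so [K] and [L] unite to a compact subset of
    [V] on which [nu] adds up. *)
Lemma inner_contentD K V : compact K -> K `<=` V ->
  (nu K)%:E + inner_content (V `\` K) <= inner_content V.
Proof.
move=> cK KV; rewrite -leeBrDl//; apply: ge_ereal_sup => _ [L [cL LVK] <-].
rewrite leeBrDl// -EFinD; have [_ _ <-] := nuP.
  apply: inner_content_ge; first exact: compactU.
  by rewrite subUset; split=> // x /LVK[].
by rewrite -subset0 => x [Kx /LVK[]].
Qed.

(** Induction on [m]: [compact_split] cuts off a compact piece of [K] inside the last open set, so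
    that finite subadditivity of [nu] suffices. *)
Lemma inner_content_finite_cover (U : (set X)^nat) K m :
  (forall n, open (U n)) -> compact K -> K `<=` \big[setU/set0]_(i < m) U i ->
  (nu K)%:E <= \sum_(0 <= i < m) inner_content (U i).
Proof.
move=> oU; elim: m K => [|m IH] K cK.
  by rewrite big_ord0 big_nil subset0 => ->; rewrite additive_prob0.
rewrite big_ord_recr/= big_nat_recr//= => KU.
have [||K1 [K2 [cK1 cK2 K1U K2U KK]]] := compact_split cK _ _ KU => //.
  by rewrite -bigcup_mkord; exact: bigcup_open.
apply: (@le_trans _ _ ((nu K1)%:E + (nu K2)%:E)).
  rewrite -EFinD lee_fin; apply: le_trans (additive_probU_le _ _ nuP).
  exact: additive_prob_le.
by apply: leeD; [exact: IH|exact: inner_content_ge].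
Qed.

Lemma inner_content_sigma_subadditive (U : (set X)^nat) :
  (forall n, open (U n)) ->
  inner_content (\bigcup_n U n) <= \sum_(n <oo) inner_content (U n).
Proof.
move=> oU; apply: ge_ereal_sup => _ [K [cK KU] <-].
have := cK; rewrite compact_cover.
move=> /(_ nat setT U (fun n _ => oU n) KU)[D _ KD].
(* One more than the largest index of the finite subcover [D], so the sets of index below [m] cover
   [K]. *)
pose m := (\max_(i <- finmap.enum_fset D) i).+1.
apply: (@le_trans _ _ (\sum_(0 <= i < m) inner_content (U i))).
  apply: inner_content_finite_cover => //; rewrite -bigcup_mkord.
  move=> x /KD[i /= iD Uix]; exists i => //=; rewrite /m ltnS.
  exact: (@leq_bigmax_seq _ _ xpredT id).
by apply: nneseries_lim_ge => n _ _; exact: inner_content_ge0.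
Qed.

Lemma outer_content_le A U : open U -> A `<=` U ->
  outer_content A <= inner_content U.
Proof. by move=> oU AU; apply: ereal_inf_lbound; exists U. Qed.

Lemma outer_contentS A B : A `<=` B -> outer_content A <= outer_content B.
Proof.
move=> AB; apply: le_ereal_inf_tmp => _ [U [oU BU] <-].
by apply: outer_content_le => //; exact: subset_trans BU.
Qed.

Lemma outer_content_open U : open U -> outer_content U = inner_content U.
Proof.
move=> oU; apply/eqP; rewrite eq_le outer_content_le//=.
by apply: le_ereal_inf_tmp => _ [V [oV UV] <-]; exact: inner_contentS.
Qed.

Lemma outer_content_ge0 A : 0 <= outer_content A.
Proof.
by apply: le_ereal_inf_tmp => _ [U _ <-]; exact: inner_content_ge0.
Qed.

Lemma outer_content_fin_num A : outer_content A \is a fin_num.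
Proof.
rewrite ge0_fin_numE ?outer_content_ge0//.
have /le_lt_trans := outer_content_le openT (@subsetT _ A); apply.
by rewrite inner_content_setT ltry.
Qed.

Lemma outer_content_approx A (e : R) : (0 < e)%R ->
  exists U, [/\ open U, A `<=` U & inner_content U <= outer_content A + e%:E].
Proof.
move=> e0; have := lb_ereal_inf_adherent e0 (outer_content_fin_num A).
by move=> [_ [U [oU AU] <-] /ltW ?]; exists U.
Qed.

Lemma outer_content0 : outer_content set0 = 0.
Proof.
apply/eqP; rewrite eq_le outer_content_ge0 andbT.
rewrite outer_content_open; last exact: open0.
apply: ge_ereal_sup => _ [K [cK KU] <-].
have := @inner_content_finite_cover (fun=> set0) K 0 (fun=> open0) cK.
by rewrite big_ord0 big_nil; exact.
Qed.

Lemma outer_content_sigma_subadditive : sigma_subadditive outer_content.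
Proof.
move=> A; apply/lee_addgt0Pr => e e0.
have /choice[U UP] : forall n, exists U, [/\ open U, A n `<=` U &
    inner_content U <= outer_content (A n) + (e / (2 ^ n.+1)%:R)%:E].
  by move=> n; apply: outer_content_approx; rewrite divr_gt0// ltr0n expn_gt0.
apply: le_trans
  (epsilon_trick xpredT (fun n => outer_content_ge0 (A n)) (ltW e0)).
have oU n : open (U n) by have [] := UP n.
apply: (@le_trans _ _ (inner_content (\bigcup_n U n))).
  apply: outer_content_le; first exact: bigcup_open.
  by apply: subset_bigcup => n _; have [] := UP n.
apply: le_trans (inner_content_sigma_subadditive oU) _.
apply: lee_nneseries => n _; first by move=> _; exact: inner_content_ge0.
by have [] := UP n.
Qed.

(** For open [V] around [A] and compact [K] inside [V] and [U], the open set [V \ K] contains the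
    part of [A] outside [U]; [inner_contentD] then bounds the two contributions by the content of
    [V]. *)
Lemma outer_content_open_split A U : open U ->
  outer_content (A `&` U) + outer_content (A `&` ~` U) <= outer_content A.
Proof.
move=> oU; apply: le_ereal_inf_tmp => _ [V [oV AV] <-].
have fD := outer_content_fin_num (A `&` ~` U).
rewrite -leeBrDr//; have oVU : open (V `&` U) by exact: openI.
apply: le_trans (outer_content_le oVU _) _; first exact: setSI.
apply: ge_ereal_sup => _ [K [cK KVU] <-].
have [KV KU] : K `<=` V /\ K `<=` U by split=> x /KVU[].
rewrite leeBrDr//; apply: le_trans (inner_contentD cK KV); rewrite leeD2l//.
apply: outer_content_le; last by move=> x [/AV Vx nUx]; split => // /KU.
by apply: openI => //; exact/closed_openC/(compact_closed hX).
Qed.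

(** By the splitting inequality open sets are Caratheodory measurable, hence so are Borel sets. The
    measure is the function [outer_content] itself, so the equality holds on every set. *)
Lemma regular_probability :
  exists mu : probability (borel X) R, forall A, mu A = outer_content A.
Proof.
pose o : {outer_measure set X -> \bar R} :=
  HB.pack outer_content (isOuterMeasure.Build R X outer_content
    outer_content0 outer_content_ge0 outer_contentS
    outer_content_sigma_subadditive).
have borel_cara : (measurable : set (set (borel X))) `<=` o.-caratheodory.
  apply: smallest_sub.
    exact: (sigma_algebra_measurable (caratheodory_type o)).
  move=> U oU; apply: le_caratheodory_measurable => A.
  exact: outer_content_open_split.
have o_sigma : semi_sigma_additive (outer_content : set (borel X) -> \bar R).
  move=> A mA tA mUA.
  apply: (@caratheodory_measure_sigma_additive R X o) => // [n|];
    exact: borel_cara.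
pose m : {measure set (borel X) -> \bar R} :=
  HB.pack (outer_content : set (borel X) -> \bar R)
    (isMeasure.Build _ (borel X) R outer_content
    outer_content0 outer_content_ge0 o_sigma).
have mT : m setT = 1.
  by rewrite /= outer_content_open ?inner_content_setT//; exact: openT.
pose P : probability (borel X) R :=
  HB.pack (outer_content : set (borel X) -> \bar R) m
    (Measure_isProbability.Build _ _ _ m mT).
by exists P.
Qed.

End regularization.

(** * Inner regularity and stationarity *)

Section stationarity.
Context (R : realType) (X : ptopologicalType).
Hypotheses (cX : compact [set: X]) (hX : hausdorff_space X).
Variable mu : probability (borel X) R.

(** Real values turn complements into subtraction in [R], where [lra] applies. *)
Let m (A : set (borel X)) : R := fine (mu A).

Let mE (A : set (borel X)) : measurable A -> mu A = (m A)%:E.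
Proof. by move=> mA; rewrite /m fineK// fin_num_measure. Qed.

Let mC (A : set (borel X)) : measurable A -> m (~` A) = 1 - m A.
Proof.
move=> mA; apply: EFin_inj; rewrite -mE; last exact: measurableC.
by rewrite probability_setC// mE.
Qed.

Let mS (A B : set (borel X)) : measurable A -> measurable B ->
  A `<=` B -> m A <= m B.
Proof.
by move=> mA mB AB; rewrite -lee_fin -!mE//; apply: le_measure; rewrite ?inE.
Qed.

Let open_borel (U : set X) : open U -> measurable (U : set (borel X)).
Proof. by move=> oU; exact: sub_sigma_algebra. Qed.

Let mu_radonP : radon mu <->
  forall (B : set (borel X)) (e : R), measurable B -> 0 < e ->
    exists K : set X, [/\ compact K, K `<=` B & (mu B <= mu K + e%:E)%E].
Proof. exact: radonP. Qed.

Lemma outer_regular_radon :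
  (forall (B : set (borel X)) (e : R), measurable B -> 0 < e ->
     exists U : set X, [/\ open U, B `<=` U & (mu U <= mu B + e%:E)%E]) ->
  radon mu.
Proof.
move=> outer; apply/mu_radonP => B e mB e0.
have mBC : measurable (~` B : set (borel X)) by exact: measurableC.
have [U [oU BU]] := outer _ _ mBC e0.
have mU := open_borel oU.
rewrite !mE// -EFinD lee_fin mC// => UB.
exists (~` U); split.
- by apply: subclosed_compact cX _ => //; exact: open_closedC.
- by move=> x nUx; apply: contrapT => /BU.
rewrite !mE//; last exact: measurableC.
by rewrite -EFinD lee_fin mC//; lra.
Qed.

Variables (N : nat) (w : 'I_N -> X -> X) (p : 'I_N -> R).
Hypotheses (cw : forall i, continuous (w i)) (p_ge0 : forall i, 0 <= p i).
Hypothesis p_sum1 : \sum_(i < N) p i = 1.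

Let mpre i (B : set (borel X)) : measurable B ->
  measurable (w i @^-1` B : set (borel X)).
Proof.
move=> mB; rewrite -[X in measurable X]setTI.
exact: continuous_borel_measurable.
Qed.

Let M (A : set (borel X)) : R := \sum_(i < N) p i * m (w i @^-1` A).

Let ME (B : set (borel X)) : measurable B -> markov_op w p mu B = (M B)%:E.
Proof.
move=> mB; rewrite /markov_op /M -sumEFin; apply: eq_bigr => i _.
by rewrite EFinM -mE//; exact: mpre.
Qed.

Let MC (A : set (borel X)) : measurable A -> M (~` A) = 1 - M A.
Proof.
move=> mA; rewrite /M -p_sum1 -sumrB; apply: eq_bigr => i _.
by rewrite preimage_setC mC ?mulrBr ?mulr1//; exact: mpre.
Qed.

Lemma radon_stationary : radon mu ->
  (forall U : set X, open U -> (mu U <= markov_op w p mu U)%E) ->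
  forall B : set (borel X), measurable B -> markov_op w p mu B = mu B.
Proof.
move=> rmu muU.
have MK (K : set X) : compact K -> M K <= m K.
  move=> cK; have mK := compact_borel hX cK.
  have oK : open (~` K) by exact/closed_openC/(compact_closed hX).
  have mCK := open_borel oK.
  by have := muU _ oK; rewrite ME// mE// lee_fin mC// MC//; lra.
have MB (B : set (borel X)) : measurable B -> M B <= m B.
  move=> mB; apply/ler_addgt0Pr => e e0.
  have /choice[K KP] i := mu_radonP.1 rmu _ _ (mpre i mB) e0.
  pose L := \big[setU/set0]_(i < N) (w i @` K i).
  have cL : compact L.
    apply: bigsetU_compact => i _; have [cK _ _] := KP i.
    by apply: continuous_compact => //; exact: continuous_subspaceT.
  have mL := compact_borel hX cL.
  have LB : L `<=` B.
    rewrite /L; elim/big_ind : _ => [//|C D CB DB|i _].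
      by rewrite subUset.
    by move=> _ [x Kx <-]; have [_ + _] := KP i; exact.
  apply: (@le_trans _ _ (m L + e)); last by rewrite lerD2r mS.
  apply: (@le_trans _ _ (M L + e)); last by rewrite lerD2r MK.
  (* As the weights sum to 1, [e] is spread over the terms as [p i * e]. *)
  rewrite -[e in leRHS]mul1r -[in leRHS]p_sum1 mulr_suml -big_split/=.
  apply: ler_sum => i _; rewrite -mulrDr ler_wpM2l//.
  have [cK KB] := KP i; have mK := compact_borel hX cK.
  rewrite !mE//; last exact: mpre.
  rewrite -EFinD lee_fin => /le_trans; apply; rewrite lerD2r mS//.
    exact: mpre.
  by move=> x Kx; rewrite /L /= (bigD1 i)//=; left; exists x.
move=> B mB; rewrite ME// mE//; congr EFin; apply/eqP; rewrite eq_le MB//=.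
by have := MB _ (measurableC mB); rewrite mC// MC//; lra.
Qed.

End stationarity.

Lemma inner_content_invariant (R : realType) (X : ptopologicalType) (N : nat)
    (w : 'I_N -> X -> X) (p : 'I_N -> R) (nu : set X -> R) (U : set X) :
  compact [set: X] -> hausdorff_space X -> (forall i, continuous (w i)) ->
  (forall i, 0 <= p i) ->
  (forall A, nu A = \sum_(i < N) p i * nu (w i @^-1` A)) ->
  (inner_content nu U <=
   \sum_(i < N) (p i)%:E * inner_content nu (w i @^-1` U))%E.
Proof.
move=> cX hX cw p0 nuM; apply: ge_ereal_sup => _ [K [cK KU] <-].
rewrite nuM -sumEFin; apply: lee_sum => i _; rewrite EFinM.
apply: lee_wpmul2l; first by rewrite lee_fin.
apply: inner_content_ge; last by move=> x /KU.
apply: subclosed_compact cX _ => //.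
have /continuous_closedP := cw i; apply; exact: compact_closed.
Qed.

Theorem theorem7p27 (R : realType) (X : ptopologicalType)
    (cX : compact [set: X]) (hX : hausdorff_space X)
    (N : nat) (w : 'I_N -> X -> X) (p : 'I_N -> R)
    (cw : forall i, continuous (w i))
    (p_gt0 : forall i, 0 < p i) (p_sum1 : \sum_(i < N) p i = 1) :
  exists mu : probability (borel X) R,
    radon mu /\
    forall B : set (borel X), measurable B -> markov_op w p mu B = mu B.
Proof.
have p_ge0 i : 0 <= p i by exact: ltW.
have [nu nuP nuM] := invariant_additive_prob w p_ge0 p_sum1.
have [mu muE] := regular_probability cX hX nuP.
have rmu : radon mu.
  (* Outer regularity is built into [outer_content], an infimum over open supersets; compactness of
     the space converts it to inner regularity. *)
  apply: outer_regular_radon => // B e mB e0.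
  have [U [oU BU UB]] := outer_content_approx cX nuP B e0.
  by exists U; split=> //; rewrite !muE outer_content_open.
exists mu; split=> //; apply: radon_stationary => // U oU.
rewrite muE outer_content_open//.
apply: le_trans (inner_content_invariant U cX hX cw p_ge0 nuM) _.
apply: lee_sum => i _; rewrite /pushforward muE outer_content_open//.
by have /continuousP := cw i; exact.
Qed.
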